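(* Let $m=1$, let $\mathbf f\equiv\mathbf 0$ and $\mathbf g\equiv\mathbf 0$, and let $\alpha>\max\{1,2/\mathrm{Re}\}$ and $\tau<\tfrac12$. Then the grad-div stabilized scheme (GD) described in the context is stable: there is a constant $C$, independent of the solution of the scheme and of the discretization parameters $\tau$ and $h$ (but possibly depending on $\mathrm{Re}$, and on the fixed problem data), such that the velocities $\mathbf u_h^\tau=\{\mathbf u_h^k\}_{k=0}^{\mathcal K}$ produced by the scheme satisfy $$\max_{0\le k\le \mathcal K}\|\mathbf u_h^k\|+\Big(\tau\sum_{k=1}^{\mathcal K}\mathcal A(\mathbf u_h^k)^2\Big)^{1/2}\le C .$$
   Context: Setting. $\Omega\subset\mathbb R^d$, $d\in\{2,3\}$, is a bounded domain with boundary $\Gamma$ and unit outward normal $\mathbf n$; $T>0$ is the final time and $\mathrm{Re}>0$ the Reynolds number. One approximates the solution $(\mathbf u,p)$ of the incompressible Navier-Stokes equations with the convective term omitted, $$\mathbf u_t-\nabla\cdot\Big(\tfrac{2}{\mathrm{Re}}\varepsilon(\mathbf u)\Big)+\nabla p=\mathbf f,\qquad \nabla\cdot\mathbf u=0\quad\text{in }\Omega\times(0,T],$$ with $\mathbf u|_{t=0}=\mathbf u_0$ and $\big(\tfrac{2}{\mathrm{Re}}\varepsilon(\mathbf u)-pI\big)\mathbf n=\mathbf g$ on $\Gamma$. There are two cases: open boundary conditions, $\varepsilon(\mathbf v)=\tfrac12\nabla\mathbf v$; and traction boundary conditions, $\varepsilon(\mathbf v)=\tfrac12(\nabla\mathbf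 v+\nabla\mathbf v^{\top})$. The result is for both cases. Notation. $(\cdot,\cdot)$ and $\|\cdot\|$ are the $L^2(\Omega)$ inner product and norm; $(\cdot,\cdot)_\Gamma$ is the $L^2(\Gamma)$ inner product. For scalar functions, $[\phi,\varphi]:=(\phi,\varphi)+(\nabla\phi,\nabla\varphi)$. The bilinear form $\mathcal A(\mathbf v,\mathbf w)$ is $\tfrac1{\mathrm{Re}}(\nabla\mathbf v,\nabla\mathbf w)$ for open boundary conditions and $\tfrac1{\mathrm{Re}}(\varepsilon(\mathbf v),\varepsilon(\mathbf w))$ for traction boundary conditions, and $\mathcal A(\mathbf v):=\mathcal A(\mathbf v,\mathbf v)^{1/2}$. Discretization. For $h>0$, $\mathbf X_h\subset H^1(\Omega)^d$ and $Q_h\subset H^1(\Omega)$ are finite dimensional spaces forming an LBB (inf-sup) stable pair; $\Pi_{\mathbf X_h},\Pi_{Q_h}$ are the $L^2$-projections onto them. $\mathcal K\in\mathbb N$ is the number of time steps, $\tau=T/\mathcal K$, $t_k=k\tau$, $\phi^k=\phi(t_k)$. Set $\delta\phi^{k+1}:=\phi^{k+1}-\phi^k$. The number $\alpha\ge1$ is a fixed user-defined parameter. Scheme (GD) for $m=1$. Initialization: $\mathbf u_h^0=\Pi_{\mathbf X_h}\mathbf u^0$, $p_h^0=\Pi_{Q_h}p^0$, $q_h^0=\psi_h^0=0$ (and $\delta\psi_h^0:=0$). For $k=0,\dots,\mathcal K-1$: 1. Velocity: find $\mathbf u_h^{k+1}\in\mathbf X_h$ such that for all $\mathbf v_h\in\mathbf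 X_h$ $$\Big(\tfrac{\delta\mathbf u_h^{k+1}}{\tau},\mathbf v_h\Big)+\mathcal A(\mathbf u_h^{k+1},\mathbf v_h)-(p_h^k+\delta\psi_h^k,\nabla\cdot\mathbf v_h)+\alpha\Big(\nabla\cdot\tfrac{\delta\mathbf u_h^{k+1}}{\tau},\nabla\cdot\mathbf v_h\Big)=(\mathbf f^{k+1},\mathbf v_h)+(\mathbf g^{k+1},\mathbf v_h)_\Gamma .$$ 2. Projection: find $\psi_h^{k+1}\in Q_h$ with $[\delta\psi_h^{k+1},z_h]=-\tfrac1\tau(\nabla\cdot\mathbf u_h^{k+1},z_h)$ for all $z_h\in Q_h$. 3. Divergence correction: find $q_h^{k+1}\in Q_h$ with $(\delta q_h^{k+1},r_h)=-(\nabla\cdot\mathbf u_h^{k+1},r_h)$ for all $r_h\in Q_h$. 4. Pressure update: $p_h^{k+1}=\psi_h^{k+1}+\tfrac1{\mathrm{Re}}q_h^{k+1}$. The fixed problem data are $\Omega$, $d$, $T$, $\alpha$ and the data used for initialization.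
   Formalization: The constant C may also depend on a number M bounding the L^2 norm of the divergence of the initial discrete velocity u_h^0; for general LBB-stable spaces the L^2-projection need not keep this bounded in h, and the bound then fails. *)

(* Defs.v *)
From HB Require Import structures.
From mathcomp Require Import all_boot all_order all_algebra.
From mathcomp Require Import all_classical all_reals all_analysis.
Set Implicit Arguments.
Unset Strict Implicit.
Unset Printing Implicit Defensive.
Import Order.TTheory GRing.Theory Num.Theory.
Import numFieldNormedType.Exports.
Local Open Scope classical_set_scope.
Local Open Scope ring_scope.

Fact rV_display : measure_display. Proof. by []. Qed.

(* The sigma-algebra on R^d generated by the coordinates (the Borel sets). *)
Section rV_measurable.
Context (R : realType) (d : nat).

Definition rV_coord (i : 'I_d) (x : 'rV[R]_d) : measurableTypeR R := x ord0 i.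

Let rV_set0 : g_sigma_preimage rV_coord set0.
Proof. exact: sigma_algebra0. Qed.

Let rV_setC A : g_sigma_preimage rV_coord A -> g_sigma_preimage rV_coord (~` A).
Proof. exact: sigma_algebraC. Qed.

Let rV_bigcup (F : (set 'rV[R]_d)^nat) :
  (forall i, g_sigma_preimage rV_coord (F i)) ->
  g_sigma_preimage rV_coord (\bigcup_i F i).
Proof. exact: sigma_algebra_bigcup. Qed.

HB.instance Definition _ := @isMeasurable.Build rV_display 'rV[R]_d
  (g_sigma_preimage rV_coord) rV_set0 rV_setC rV_bigcup.

End rV_measurable.

Section measurable_pushforward.
Context d1 d2 (T1 : measurableType d1) (T2 : measurableType d2) (R : realType).
Variables (m : {measure set T1 -> \bar R}) (f : T1 -> T2).

Definition mpushforward of measurable_fun setT f := pushforward m f.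

Variable mf : measurable_fun setT f.
HB.instance Definition _ := Measure.copy (mpushforward mf)
  (measure_function_pushforward__canonical__measure_function_Measure m mf).

End measurable_pushforward.

Section lebesgue.
Context (R : realType).

Lemma measurable_tcons n : measurable_fun setT
  (fun z : n.-tuple (measurableTypeR R) * measurableTypeR R =>
     [the n.+1.-tuple (measurableTypeR R) of z.2 :: z.1]).
Proof. exact: measurable_cons. Qed.

Fixpoint lebesgue_tuple n :
    {measure set (n.-tuple (measurableTypeR R)) -> \bar R} :=
  match n with
  | 0 => dirac [tuple]
  | n'.+1 =>
    mpushforward (lebesgue_tuple n' \x (@lebesgue_measure R))%E
      (@measurable_tcons n')
  end.

Lemma measurable_rV_of_tuple d : measurable_fun setT
  (fun t : d.-tuple (measurableTypeR R) => (\row_i tnth t i : 'rV[R]_d)).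
Proof.
move=> _ B mB; rewrite setTI.
have /= := g_sigma_preimage_comp (@rV_coord R d)
  (fun t : d.-tuple (measurableTypeR R) => (\row_i tnth t i : 'rV[R]_d)).
move=> /(congr1 (fun S : set (set _) => S ((fun t => \row_i tnth t i) @^-1` B))).
have -> : (fun i => rV_coord i \o (fun t : d.-tuple (measurableTypeR R) =>
    (\row_j tnth t j : 'rV[R]_d))) = (fun i t => tnth t i).
  by apply/funext => i; apply/funext => t; rewrite /= /rV_coord mxE.
rewrite /measurable /= => ->.
by exists B => //; rewrite setTI.
Qed.

Definition lebesgue_rV d : {measure set 'rV[R]_d -> \bar R} :=
  mpushforward (lebesgue_tuple d) (@measurable_rV_of_tuple d).

End lebesgue.

Section domain.
Context (R : realType) (d : nat).
Local Notation E := 'rV[R]_d.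

Definition bounded_domain (Omega : set E) : Prop :=
  [/\ Omega !=set0, open Omega, connected Omega & bounded_set Omega].

Definition iter_partial (s : seq 'I_d) (phi : E -> R) : E -> R :=
  foldr (fun i f => 'D_(delta_mx ord0 i) f) phi s.

Definition smooth (phi : E -> R) : Prop := forall s : seq 'I_d,
  continuous (iter_partial s phi) /\
  forall i x, derivable (iter_partial s phi) x (delta_mx ord0 i).

Definition test_function (Omega : set E) (phi : E -> R) : Prop :=
  [/\ smooth phi, compact (closure [set x | phi x != 0]) &
      closure [set x | phi x != 0] `<=` Omega].

End domain.

(* An element of H^1(Omega) is represented by a pair w: w.1 is the function and
   w.2 i is its i-th weak partial derivative.  Weak derivatives are unique up
   to null sets, so (modulo a.e. equality, to which every form below is
   insensitive) these pairs are H^1(Omega).  A vector field is a family of d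
   such pairs; the linear structure is the pointwise one. *)
Notation scalar_pair R d :=
  (('rV[R]_d -> R) * ('I_d -> 'rV[R]_d -> R))%type (only parsing).
Notation vector_pair R d := ('I_d -> scalar_pair R d) (only parsing).

Section sobolev.
Context (R : realType) (d : nat) (Omega : set 'rV[R]_d).
Local Notation E := 'rV[R]_d.
Local Notation leb := (lebesgue_rV R d).

Definition L2 (f : E -> R) : Prop :=
  measurable_fun Omega f /\ leb.-integrable Omega (fun x => (f x ^+ 2)%:E).

Definition ip (f g : E -> R) : R := \int[leb]_(x in Omega) (f x * g x).

Definition L2norm (f : E -> R) : R := Num.sqrt (ip f f).

Definition weak_partial (i : 'I_d) (f g : E -> R) : Prop :=
  forall phi, test_function Omega phi ->
    \int[leb]_(x in Omega) (f x * 'D_(delta_mx ord0 i) phi x) =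
    - \int[leb]_(x in Omega) (g x * phi x).

Definition H1 (w : scalar_pair R d) : Prop :=
  [/\ L2 w.1, (forall i, L2 (w.2 i)) & forall i, weak_partial i w.1 (w.2 i)].

(* [phi, psi] = (phi, psi) + (grad phi, grad psi) *)
Definition H1ip (w z : scalar_pair R d) : R :=
  ip w.1 z.1 + \sum_i ip (w.2 i) (z.2 i).

Definition vip (v w : 'I_d -> E -> R) : R := \sum_i ip (v i) (w i).

Definition tip (S U : 'I_d -> 'I_d -> E -> R) : R :=
  \sum_i \sum_j ip (S i j) (U i j).

Definition fld (v : vector_pair R d) : 'I_d -> E -> R := fun i => (v i).1.

Definition grad (v : vector_pair R d) : 'I_d -> 'I_d -> E -> R :=
  fun i j => (v i).2 j.

Definition div (v : vector_pair R d) : E -> R :=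
  fun x => \sum_i (v i).2 i x.

Definition vL2norm (v : vector_pair R d) : R := Num.sqrt (vip (fld v) (fld v)).

Definition vH1norm (v : vector_pair R d) : R :=
  Num.sqrt (vip (fld v) (fld v) + tip (grad v) (grad v)).

End sobolev.

Inductive boundary_condition := Open_bc | Traction_bc.

Section discretization.
Context (R : realType) (d : nat) (Omega : set 'rV[R]_d).
Local Notation E := 'rV[R]_d.

Definition strain (v : vector_pair R d) : 'I_d -> 'I_d -> E -> R :=
  fun i j x => 2^-1 * (grad v i j x + grad v j i x).

Definition Aform (bc : boundary_condition) (Re : R) (v w : vector_pair R d) : R :=
  match bc with
  | Open_bc => Re^-1 * tip Omega (grad v) (grad w)
  | Traction_bc => Re^-1 * tip Omega (strain v) (strain w)
  end.

Definition Anorm bc Re (v : vector_pair R d) : R := Num.sqrt (Aform bc Re v v).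

Definition fin_dim_subspace (V : lmodType R) (X : set V) : Prop :=
  exists (n : nat) (b : 'I_n -> V),
    X = [set v | exists c : 'I_n -> R, v = \sum_i c i *: b i].

Definition velocity_space (X : set (vector_pair R d)) : Prop :=
  fin_dim_subspace X /\ forall v, X v -> forall i, H1 Omega (v i).

Definition pressure_space (Q : set (scalar_pair R d)) : Prop :=
  fin_dim_subspace Q /\ Q `<=` H1 Omega.

Definition infsup (X : set (vector_pair R d)) (Q : set (scalar_pair R d)) :
    \bar R :=
  ereal_inf [set ereal_sup
      [set (ip Omega r.1 (div v) / (L2norm Omega r.1 * vH1norm Omega v))%:E
      | v in X `&` [set v | vH1norm Omega v != 0]]
    | r in Q `&` [set r | L2norm Omega r.1 != 0]].

Definition LBB_stable (X : R -> set (vector_pair R d))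
    (Q : R -> set (scalar_pair R d)) : Prop :=
  exists beta : R, 0 < beta /\
    forall h, 0 < h -> (beta%:E <= infsup (X h) (Q h))%E.

Definition is_velocity_projection (X : set (vector_pair R d))
    (u0 : 'I_d -> E -> R) (u : vector_pair R d) : Prop :=
  X u /\ forall v, X v -> vip Omega (fld u) (fld v) = vip Omega u0 (fld v).

Definition is_pressure_projection (Q : set (scalar_pair R d))
    (p0 : E -> R) (p : scalar_pair R d) : Prop :=
  Q p /\ forall r, Q r -> ip Omega p.1 r.1 = ip Omega p0 r.1.

(* delta phi k is phi^k - phi^(k-1), with the convention delta phi^0 = 0. *)
Definition delta (V : zmodType) (phi : nat -> V) (k : nat) : V :=
  if k is k'.+1 then phi k - phi k' else 0.

(* gload t v stands for the boundary term (g(t), v)_Gamma. *)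
Record GD_scheme (bc : boundary_condition) (Re alpha tau : R) (K : nat)
    (f : R -> 'I_d -> E -> R) (gload : R -> vector_pair R d -> R)
    (X : set (vector_pair R d)) (Q : set (scalar_pair R d))
    (u0 : 'I_d -> E -> R) (p0 : E -> R)
    (u : nat -> vector_pair R d) (psi q p : nat -> scalar_pair R d) : Prop := {
  GD_init_u : is_velocity_projection X u0 (u 0%N);
  GD_init_p : is_pressure_projection Q p0 (p 0%N);
  GD_init_q : q 0%N = 0;
  GD_init_psi : psi 0%N = 0;
  GD_mem : forall k, (k < K)%N -> [/\ X (u k.+1), Q (psi k.+1) & Q (q k.+1)];
  GD_velocity : forall k, (k < K)%N -> forall v, X v ->
    vip Omega (fld (tau^-1 *: delta u k.+1)) (fld v)
    + Aform bc Re (u k.+1) v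
    - ip Omega (p k + delta psi k).1 (div v)
    + alpha * ip Omega (div (tau^-1 *: delta u k.+1)) (div v)
    = vip Omega (f (k.+1%:R * tau)) (fld v) + gload (k.+1%:R * tau) v;
  GD_projection : forall k, (k < K)%N -> forall z, Q z ->
    H1ip Omega (delta psi k.+1) z = - (tau^-1 * ip Omega (div (u k.+1)) z.1);
  GD_correction : forall k, (k < K)%N -> forall r, Q r ->
    ip Omega (delta q k.+1).1 r.1 = - ip Omega (div (u k.+1)) r.1;
  GD_pressure : forall k, (k < K)%N -> p k.+1 = psi k.+1 + Re^-1 *: q k.+1
}.

End discretization.

(* Main.v *)
Require Import Defs.
From mathcomp Require Import all_boot all_order all_algebra.
From mathcomp Require Import all_classical all_reals all_analysis.
From mathcomp Require Import measurable_realfun ring lra.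
Import Order.TTheory GRing.Theory Num.Theory.
Import numFieldNormedType.Exports.
Local Open Scope classical_set_scope.
Local Open Scope ring_scope.
Set Implicit Arguments.
Unset Strict Implicit.
Unset Printing Implicit Defensive.

(** The scheme controls the energy
      E^k = |u^k|^2 + alpha |div u^k|^2 + tau^2 [psi^k, psi^k]
            + (tau / Re) |q^k|^2.
    Testing the momentum equation with 2 tau u^(k+1) makes the time differences
    telescope and leaves the pressure term
      2 tau (psi^k + delta psi^k + q^k / Re, div u^(k+1)).
    The projection and correction steps rewrite (z, div u^(k+1)) as
    - tau [delta psi^(k+1), z] and as - (delta q^(k+1), z), so this term becomes
    a telescoping sum of squares of psi and q with two error terms of the bad
    sign ([energy_step]):
    - tau^2 [w, w] with w = delta psi^(k+1) - delta psi^k the second difference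
      of psi.  It solves the projection problem for the increment of div u, so
      [pressure_solve_le] bounds this error by |delta div u^(k+1)|^2.  The
      grad-div term provides alpha |delta div u^(k+1)|^2, and alpha > 1.
    - (tau / Re) |delta q^(k+1)|^2, at most (tau / Re) |div u^(k+1)|^2 because
      delta q^(k+1) is an L2-projection of - div u^(k+1).  Since alpha > 2 / Re
      this is at most (tau / 2) E^(k+1).
    Hence E^(k+1) - E^k + 2 tau A(u^(k+1))^2 <= (tau / 2) E^(k+1) for k >= 1,
    and [discrete_gronwall] concludes for tau < 1 / 2.

    The step k = 0 is different, because p^0 is not psi^0 + q^0 / Re but a
    projection of the initial pressure.  There (p^0, div u^1) is absorbed with
    Young's inequality, which bounds E^1 by |u^0|^2, |div u^0|^2 and |p^0|^2
    ([first_energy_step]); the L2-projections at initialization bound |u^0| and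
    |p^0| by the data.

    This argument uses only bilinear algebra, so it is carried out for abstract
    positive semidefinite forms; [psd_form] and its closure properties then
    supply the integral forms of the scheme. *)

(** * Positive semidefinite forms on a subspace *)

(** Bilinearity is required only on S because integral forms are linear only on
    square integrable functions. *)
Record psd_form (R : realType) (V : lmodType R) (S : set V) (b : V -> V -> R)
    : Prop := PsdForm {
  psd_dom0 : S 0;
  psd_domP : forall a u v, S u -> S v -> S (a *: u + v);
  psd_sym : forall u v, S u -> S v -> b u v = b v u;
  psd_lin : forall a u v w, S u -> S v -> S w ->
    b (a *: u + v) w = a * b u w + b v w;
  psd_ge0 : forall u, S u -> 0 <= b u u }.

Section psd_theory.
Context (R : realType) (V : lmodType R) (S : set V) (b : V -> V -> R).
Hypothesis H : psd_form S b.

Lemma psd_domZ a u : S u -> S (a *: u).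
Proof.
move=> Su; rewrite -[_ *: _]addr0; apply: (psd_domP H) => //.
exact: psd_dom0 H.
Qed.

Lemma psd_domD u v : S u -> S v -> S (u + v).
Proof. by move=> Su Sv; rewrite -[u]scale1r; apply: (psd_domP H). Qed.

Lemma psd_domB u v : S u -> S v -> S (u - v).
Proof.
by move=> Su Sv; rewrite addrC -scaleN1r; apply: (psd_domP H).
Qed.

Lemma psdDl u v w : S u -> S v -> S w -> b (u + v) w = b u w + b v w.
Proof.
by move=> Su Sv Sw; rewrite -[u in LHS]scale1r (psd_lin H) // mul1r.
Qed.

Lemma psd0l w : S w -> b 0 w = 0.
Proof.
move=> Sw; have S0 := psd_dom0 H.
by have := psdDl S0 S0 Sw; rewrite addr0; lra.
Qed.

Lemma psdZl a u w : S u -> S w -> b (a *: u) w = a * b u w.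
Proof.
move=> Su Sw; have S0 := psd_dom0 H.
by rewrite -[_ *: _]addr0 (psd_lin H) // psd0l // addr0.
Qed.

Lemma psdBl u v w : S u -> S v -> S w -> b (u - v) w = b u w - b v w.
Proof.
by move=> Su Sv Sw; rewrite addrC -scaleN1r (psd_lin H) // mulN1r addrC.
Qed.

(** Polarization: pairing an increment with the new value telescopes, with a
    nonnegative remainder. *)
Lemma psd_increment u v : S u -> S v ->
  2 * b (u - v) u = b u u - b v v + b (u - v) (u - v).
Proof.
move=> Su Sv; have Sd := psd_domB Su Sv.
rewrite (@psdBl _ _ (u - v)) // (@psd_sym _ _ _ _ H u (u - v)) //.
rewrite (@psd_sym _ _ _ _ H v (u - v)) // !psdBl //.
rewrite (@psd_sym _ _ _ _ H v u) //.
ring.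
Qed.

(** Pairing with the old value telescopes too, but the remainder has
    the opposite sign. *)
Lemma psd_increment_old u v : S u -> S v ->
  2 * b (u - v) v = b u u - b v v - b (u - v) (u - v).
Proof.
move=> Su Sv; have Sd := psd_domB Su Sv.
have e : b (u - v) v = b (u - v) u - b (u - v) (u - v).
  rewrite (@psd_sym _ _ _ _ H (u - v) v) // (@psd_sym _ _ _ _ H (u - v) u) //.
  by rewrite -psdBl // subKr.
have := psd_increment Su Sv; lra.
Qed.

(** The extrapolation v + (v - u) differs from the new value w by the second
    difference, so polarization applies at w and again at w - v. *)
Lemma psd_extrapolation u v w : S u -> S v -> S w ->
  2 * b (w - v) (v + (v - u)) = b w w - b v v + b (v - u) (v - u)
    - b ((w - v) - (v - u)) ((w - v) - (v - u)).
Proof.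
move=> Su Sv Sw; have Sd1 := psd_domB Sv Su; have Sd2 := psd_domB Sw Sv.
have Sdd := psd_domB Sd2 Sd1; have Sx := psd_domB Sw Sdd.
have -> : v + (v - u) = w - ((w - v) - (v - u)).
  by rewrite opprB [RHS]addrCA subKr addrC.
rewrite (psd_sym H Sd2 Sx) psdBl // (psd_sym H Sw Sd2).
have := psd_increment Sw Sv; have := psd_increment Sd2 Sd1; lra.
Qed.

Lemma psd_young u v : S u -> S v -> 2 * b u v <= b u u + b v v.
Proof.
move=> Su Sv; have Sd := psd_domB Su Sv.
have := psd_ge0 H Sd.
rewrite (@psdBl _ _ (u - v)) // (@psd_sym _ _ _ _ H u (u - v)) //.
rewrite (@psd_sym _ _ _ _ H v (u - v)) // !psdBl //.
rewrite (@psd_sym _ _ _ _ H v u) //.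
lra.
Qed.

(** The hypothesis is what remains of u being a projection of v after testing
    with u itself. *)
Lemma psd_projection_le u v : S u -> S v -> b u u = b v u -> b u u <= b v v.
Proof. by move=> Su Sv e; have := psd_young Sv Su; lra. Qed.

End psd_theory.

Section psd_constructions.
Context (R : realType).

Lemma psd_pullback (V W : lmodType R) (S : set V) (S' : set W) b (f : W -> V) :
  psd_form S b ->
  S' 0 -> (forall a u v, S' u -> S' v -> S' (a *: u + v)) ->
  (forall w, S' w -> S (f w)) ->
  (forall a u v, f (a *: u + v) = a *: f u + f v) ->
  psd_form S' (fun u v => b (f u) (f v)).
Proof.
move=> H S0 SP fS fl; split => //.
- by move=> u v Su Sv; apply: (psd_sym H); apply: fS.
- by move=> a u v w Su Sv Sw; rewrite fl (psd_lin H) //; apply: fS.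
- by move=> u Su; apply: (psd_ge0 H); apply: fS.
Qed.

Lemma psd_sum (I : finType) (V : lmodType R) (S : set V)
    (b : I -> V -> V -> R) :
  S 0 -> (forall a u v, S u -> S v -> S (a *: u + v)) ->
  (forall i, psd_form S (b i)) ->
  psd_form S (fun u v => \sum_i b i u v).
Proof.
move=> S0 SP H; split => //.
- by move=> u v Su Sv; apply: eq_bigr => i _; apply: (psd_sym (H i)).
- move=> a u v w Su Sv Sw; rewrite mulr_sumr -big_split /=.
  by apply: eq_bigr => i _; apply: (psd_lin (H i)).
- by move=> u Su; apply: sumr_ge0 => i _; apply: (psd_ge0 (H i)).
Qed.

Lemma psd_add (V : lmodType R) (S : set V) (b c : V -> V -> R) :
  psd_form S b -> psd_form S c -> psd_form S (fun u v => b u v + c u v).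
Proof.
move=> Hb Hc; split; [exact: psd_dom0 Hb|exact: psd_domP Hb| | |].
- by move=> u v Su Sv; rewrite (psd_sym Hb) // (psd_sym Hc).
- move=> a u v w Su Sv Sw; rewrite (psd_lin Hb) // (psd_lin Hc) //; ring.
- by move=> u Su; rewrite addr_ge0 ?(psd_ge0 Hb) ?(psd_ge0 Hc).
Qed.

Lemma psd_scale (V : lmodType R) (S : set V) (b : V -> V -> R) (c : R) :
  0 <= c -> psd_form S b -> psd_form S (fun u v => c * b u v).
Proof.
move=> c0 H; split; [exact: psd_dom0 H|exact: psd_domP H| | |].
- by move=> u v Su Sv; rewrite (psd_sym H).
- by move=> a u v w Su Sv Sw; rewrite (psd_lin H) //; ring.
- by move=> u Su; rewrite mulr_ge0 ?(psd_ge0 H).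
Qed.

End psd_constructions.

(** * The discrete Gronwall inequality *)

(** The implicit error term tau / 2 * E k.+1 is absorbed on the left, which is
    why tau has to be bounded away from 2; the sum of the dissipation a then
    follows by adding up the steps with E already bounded. *)
Lemma discrete_gronwall (R : realType) (E a : nat -> R) (K : nat) (tau G : R) :
  0 < tau -> tau < 1 / 2 -> 0 <= G ->
  (forall k, 0 <= E k) ->
  (forall k, (1 <= k <= K)%N -> 0 <= a k) ->
  E 1%N + 2 * tau * a 1%N <= G ->
  (forall k, (1 <= k < K)%N ->
     E k.+1 - E k + 2 * tau * a k.+1 <= tau / 2 * E k.+1) ->
  forall n, (n < K)%N ->
    E n.+1 <= expR (K%:R * tau) * G /\
    tau * \sum_(1 <= k < n.+2) a k
      <= G * (1 + K%:R * tau * expR (K%:R * tau)).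
Proof.
move=> tau0 tau12 G0 E0 a0 E1 step.
set eT := expR _.
have bound n : (n < K)%N -> E n.+1 <= eT * G.
  move=> nK; suff le_pow : E n.+1 <= (1 + tau) ^+ n * G.
    apply: le_trans le_pow _; apply: ler_wpM2r => //.
    apply: le_trans (_ : expR tau ^+ n <= _).
      by rewrite lerXn2r ?nnegrE ?expR_ge0 ?expR_ge1Dx ?addr_ge0 // ltW.
    by rewrite -expRM_natl ler_expR ler_pM2r // ler_nat ltnW.
  elim: n nK => [|n IH] nK.
    have a1 := a0 1%N nK.
    have : 0 <= tau * a 1%N by rewrite mulr_ge0 // ltW.
    rewrite expr0 mul1r; lra.
  have := step n.+1; rewrite /= nK => /(_ isT) st.
  have ta0 : 0 <= tau * a n.+2 by rewrite mulr_ge0 ?(ltW tau0) // a0.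
  have x0 := E0 n.+2; have yP := IH (ltnW nK).
  have contract : (1 - tau / 2) * E n.+2 <= (1 + tau) ^+ n * G by lra.
  (* (1 + tau) (1 - tau / 2) >= 1 for tau <= 1, so dividing by 1 - tau / 2
     costs at most a factor 1 + tau *)
  rewrite exprS -mulrA.
  apply: le_trans (_ : (1 + tau) * ((1 - tau / 2) * E n.+2) <= _).
    have : 0 <= tau * (1 - tau) * E n.+2 by rewrite !mulr_ge0 //; lra.
    lra.
  by rewrite ler_pM2l //; lra.
move=> n nK; split; first exact: bound.
suff : E n.+1 + 2 * (tau * \sum_(1 <= k < n.+2) a k)
    <= G + n%:R * (tau / 2 * (eT * G)).
  have := E0 n.+1.
  have : n%:R * (tau / 2 * (eT * G)) <= K%:R * (tau * (eT * G)).
    rewrite ler_pM ?ler0n ?ler_nat ?(ltnW nK) //.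
      by rewrite !mulr_ge0 ?expR_ge0 // ltW // divr_gt0.
    rewrite ler_wpM2r ?mulr_ge0 ?expR_ge0 //; lra.
  have : 0 <= K%:R * (tau * (eT * G)) by rewrite !mulr_ge0 ?expR_ge0 // ltW.
  lra.
elim: n nK => [|n IH] nK; first by rewrite big_nat1 mul0r addr0 mulrA.
rewrite big_nat_recr //=; have := IH (ltnW nK).
have := step n.+1; rewrite /= nK => /(_ isT) st.
have : tau / 2 * E n.+2 <= tau / 2 * (eT * G).
  by rewrite ler_pM2l ?bound // divr_gt0.
rewrite -[n.+1%:R]natr1; lra.
Qed.

(** * Stability of the scheme for abstract forms *)

Section abstract_scheme.
(** V carries the velocities, W the H1 pressures, L the L2 scalar fields; dv is
    the divergence, j forgets the gradient of a pressure, and rho stands for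
    1 / Re. *)
Context (R : realType) (V W L : lmodType R).
Context (X : set V) (Q : set W) (S : set L).
Context (mass A : V -> V -> R) (l : L -> L -> R) (e : W -> W -> R).
Context (dv : V -> L) (j : W -> L).
Hypotheses (massP : psd_form X mass) (AP : psd_form X A).
Hypotheses (lP : psd_form S l) (eP : psd_form Q e).
Hypotheses (dvS : forall v, X v -> S (dv v)) (jS : forall w, Q w -> S (j w)).
Hypothesis dv_lin : forall a u v, dv (a *: u + v) = a *: dv u + dv v.
Hypothesis j_lin : forall a u v, j (a *: u + v) = a *: j u + j v.
Hypothesis j_le : forall w, Q w -> l (j w) (j w) <= e w w.
Context (tau alpha rho : R).
Hypotheses (tau0 : 0 < tau) (tau12 : tau < 1 / 2).
Hypotheses (alpha1 : 1 < alpha) (alpha_rho : 2 * rho < alpha).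
Hypothesis rho0 : 0 <= rho.

Definition scheme_energy (u : V) (psi q : W) : R :=
  mass u u + alpha * l (dv u) (dv u) + tau ^+ 2 * e psi psi
  + tau * rho * l (j q) (j q).

Let ljP : psd_form Q (fun w z => l (j w) (j z)).
Proof.
apply: psd_pullback lP _ _ _ _ => //; first exact: psd_dom0 eP.
exact: psd_domP eP.
Qed.

Let dvB u v : dv (u - v) = dv u - dv v.
Proof. by rewrite addrC -scaleN1r dv_lin scaleN1r addrC. Qed.

Let dvZ a u : dv (a *: u) = a *: dv u.
Proof.
have dv0 : dv 0 = 0 by rewrite -[X in dv X](subrr 0) dvB subrr.
by rewrite -[X in dv X]addr0 dv_lin dv0 addr0.
Qed.

(** Testing with w and applying Young's inequality to - D and tau w leaves
    tau ^ 2 l (j w) (j w), which the stronger form e absorbs. *)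
Lemma pressure_solve_le w D : Q w -> S D ->
  (forall z, Q z -> e w z = - (tau^-1 * l D (j z))) ->
  tau ^+ 2 * e w w <= l D D.
Proof.
move=> Qw SD Hw; have Sjw := jS Qw.
have SD' := psd_domZ lP (-1) SD; have Sw' := psd_domZ lP tau Sjw.
have := psd_young lP SD' Sw'.
rewrite !(psdZl lP) // !(psd_sym lP _ Sw') // !(psd_sym lP _ SD') //.
rewrite !(psdZl lP) //.
rewrite (psd_sym lP Sjw SD); have := j_le Qw; have := Hw w Qw.
set b := l D (j w); set c := l (j w) (j w); set g := e w w; set f := l D D.
move=> gE cg yng.
have gE' : tau ^+ 2 * g = - (tau * b).
  by rewrite gE; field; rewrite gt_eqF.
have : tau ^+ 2 * c <= tau ^+ 2 * g by rewrite ler_pM2l // exprn_gt0.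
lra.
Qed.

Lemma correction_le r D : Q r -> S D ->
  (forall z, Q z -> l (j r) (j z) = - l D (j z)) -> l (j r) (j r) <= l D D.
Proof.
move=> Qr SD Hr; have Sj := jS Qr; have SN := psd_domZ lP (-1) SD.
have := @psd_projection_le _ _ _ _ lP _ _ Sj SN.
rewrite !(psdZl lP) // (psd_sym lP SD SN) (psdZl lP) // Hr //.
by rewrite mulN1r !mulN1r opprK; apply.
Qed.

(** The momentum equation tested with 2 tau u', for any explicit pressure P; the
    square of the velocity increment is dropped, that of the divergence
    increment is kept to pay for the extrapolation of psi. *)
Lemma momentum_energy u u' P : X u -> X u' -> S P ->
  mass (tau^-1 *: (u' - u)) u' + A u' u' - l P (dv u')
    + alpha * l (dv (tau^-1 *: (u' - u))) (dv u') = 0 ->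
  mass u' u' - mass u u + 2 * tau * A u' u'
    + alpha * (l (dv u') (dv u') - l (dv u) (dv u))
    + alpha * l (dv u' - dv u) (dv u' - dv u) <= 2 * tau * l P (dv u').
Proof.
move=> Xu Xu' SP; have Xd := psd_domB massP Xu' Xu.
have SD := dvS Xu; have SD' := dvS Xu'; have Sd := psd_domB lP SD' SD.
rewrite dvZ dvB (psdZl massP) // (psdZl lP) //.
have := psd_increment massP Xu' Xu; have := psd_increment lP SD' SD.
have := psd_ge0 massP Xd.
set m := mass (u' - u) u'; set n := l (dv u' - dv u) (dv u').
set y := l P (dv u'); set a := A u' u'.
move=> m0 nE mE vel.
have : 2 * m + 2 * tau * a - 2 * tau * y + alpha * (2 * n) = 0.
  rewrite -[RHS](mulr0 (2 * tau)) -vel; field; rewrite gt_eqF //.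
have := congr1 ( *%R alpha) nE; lra.
Qed.

(** The first step is excluded: only from the second one on is the pressure of
    the form psi + rho q, and the bound on the second difference of psi compares
    the projection equations of two consecutive steps. *)
Lemma energy_step u u' psi0 psi1 psi2 q1 q2 :
  X u -> X u' -> Q psi0 -> Q psi1 -> Q psi2 -> Q q1 -> Q q2 ->
  mass (tau^-1 *: (u' - u)) u' + A u' u'
    - l (j (psi1 + rho *: q1 + (psi1 - psi0))) (dv u')
    + alpha * l (dv (tau^-1 *: (u' - u))) (dv u') = 0 ->
  (forall z, Q z -> e (psi1 - psi0) z = - (tau^-1 * l (dv u) (j z))) ->
  (forall z, Q z -> e (psi2 - psi1) z = - (tau^-1 * l (dv u') (j z))) ->
  (forall r, Q r -> l (j (q2 - q1)) (j r) = - l (dv u') (j r)) ->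
  scheme_energy u' psi2 q2 - scheme_energy u psi1 q1 + 2 * tau * A u' u'
    <= tau / 2 * scheme_energy u' psi2 q2.
Proof.
move=> Xu Xu' Q0 Q1 Q2 Qq1 Qq2.
have Qd1 := psd_domB eP Q1 Q0; have Qd2 := psd_domB eP Q2 Q1.
have Qw := psd_domB eP Qd2 Qd1; have Qz := psd_domD eP Q1 Qd1.
have Qdq := psd_domB eP Qq2 Qq1.
have SD := dvS Xu; have SD' := dvS Xu'; have Sd := psd_domB lP SD' SD.
rewrite [psi1 + rho *: q1]addrC -(addrA (rho *: q1)) => vel H1 H2 Hq.
have Sq1 := jS Qq1; have Sz := jS Qz.
have SP : S (j (rho *: q1 + (psi1 + (psi1 - psi0)))).
  by apply: jS; apply: (psd_domP eP).
have := momentum_energy Xu Xu' SP vel; rewrite {vel SP}.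
have -> : l (j (rho *: q1 + (psi1 + (psi1 - psi0)))) (dv u') =
    rho * l (dv u') (j q1) + l (dv u') (j (psi1 + (psi1 - psi0))).
  by rewrite j_lin (psd_lin lP) // !(psd_sym lP _ SD').
have psi_pairing : tau * l (dv u') (j (psi1 + (psi1 - psi0))) =
    - (tau ^+ 2 * e (psi2 - psi1) (psi1 + (psi1 - psi0))).
  by rewrite H2 //; field; rewrite gt_eqF.
have q_pairing : l (dv u') (j q1) = - l (j (q2 - q1)) (j q1).
  by rewrite Hq // opprK.
have psi_telescope := psd_extrapolation eP Q0 Q1 Q2.
have /= q_telescope := psd_increment_old ljP Qq2 Qq1.
(* the second difference of psi solves the projection problem for the increment
   of the divergence *)
have second_difference : tau ^+ 2 *
    e (psi2 - psi1 - (psi1 - psi0)) (psi2 - psi1 - (psi1 - psi0))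
    <= l (dv u' - dv u) (dv u' - dv u).
  apply: pressure_solve_le => // z Qz'.
  by rewrite (psdBl eP) // H1 // H2 // (psdBl lP) //; try exact: jS; ring.
have q_difference := correction_le Qdq SD' Hq.
have d1_ge0 := psd_ge0 eP Qd1; have u_ge0 := psd_ge0 massP Xu'.
have D_ge0 := psd_ge0 lP SD'; have dD_ge0 := psd_ge0 lP Sd.
have psi_ge0 := psd_ge0 eP Q2; have /= q_ge0 := psd_ge0 ljP Qq2.
rewrite /scheme_energy; move: psi_pairing q_pairing psi_telescope q_telescope.
move: second_difference q_difference d1_ge0 u_ge0 D_ge0 dD_ge0 psi_ge0 q_ge0.
set dDD := l (dv u' - dv u) _; set D' := l (dv u') (dv u').
set Dz := l (dv u') (j (psi1 + _)); set Dq := l (dv u') (j q1).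
set ww := e (psi2 - psi1 - _) _; set d1 := e (psi1 - psi0) _.
set d2z := e (psi2 - psi1) _; set p1 := e psi1 _; set p2 := e psi2 _.
set dqdq := l (j (q2 - q1)) (j (q2 - q1)); set dqq := l (j (q2 - q1)) (j q1).
set q1q1 := l (j q1) (j q1); set q2q2 := l (j q2) (j q2).
move=> second_difference q_difference d1_ge0 u_ge0 D_ge0 dD_ge0 psi_ge0 q_ge0.
move=> psi_pairing q_pairing psi_telescope q_telescope momentum.
have pressure_work : 2 * tau * (rho * Dq + Dz) =
    - (tau * rho * (q2q2 - q1q1 - dqdq)) - tau ^+ 2 * (p2 - p1 + d1 - ww).
  rewrite -q_telescope -psi_telescope.
  have -> : 2 * tau * (rho * Dq + Dz) = tau * rho * (2 * Dq) + 2 * (tau * Dz).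
    by ring.
  by rewrite psi_pairing q_pairing; ring.
have grad_div : dDD <= alpha * dDD by rewrite ler_peMl // ltW.
have tr0 : 0 <= tau * rho by rewrite mulr_ge0 // ltW.
have q_error : tau * rho * dqdq <= tau * rho * D' by rewrite ler_wpM2l.
have rho_le : rho <= alpha / 2 by have := alpha_rho; lra.
have D_le : tau * rho * D' <= tau / 2 * (alpha * D').
  have -> : tau / 2 * (alpha * D') = tau * (alpha / 2 * D') by ring.
  by rewrite -mulrA ler_pM2l //; apply: ler_wpM2r.
have td1 : 0 <= tau ^+ 2 * d1 by rewrite mulr_ge0 // sqr_ge0.
have rest : 0 <= tau / 2 * (mass u' u' + tau ^+ 2 * p2 + tau * rho * q2q2).
  by rewrite mulr_ge0 ?divr_ge0 ?addr_ge0 ?mulr_ge0 ?sqr_ge0 // ltW.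
lra.
Qed.

(** The explicit pressure P is arbitrary here: its work is absorbed in
    alpha l (dv u') (dv u'), and psi1, q1 are increments from 0, controlled by
    the divergence alone.  With B the initial energy on the right and D' the new
    squared divergence, absorption gives D' <= 2 B; the momentum balance costs
    B + D' / 2, psi1 costs D' and q1 costs rho D' / 2. *)
Lemma first_energy_step u u' P psi1 q1 :
  X u -> X u' -> S P -> Q psi1 -> Q q1 ->
  mass (tau^-1 *: (u' - u)) u' + A u' u' - l P (dv u')
    + alpha * l (dv (tau^-1 *: (u' - u))) (dv u') = 0 ->
  (forall z, Q z -> e psi1 z = - (tau^-1 * l (dv u') (j z))) ->
  (forall r, Q r -> l (j q1) (j r) = - l (dv u') (j r)) ->
  scheme_energy u' psi1 q1 + 2 * tau * A u' u'
    <= (4 + rho) * (mass u u + alpha * l (dv u) (dv u) + l P P).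
Proof.
move=> Xu Xu' SP Q1 Qq1 /(momentum_energy Xu Xu' SP) ME H1 Hq.
have SD := dvS Xu; have SD' := dvS Xu'; have Sd := psd_domB lP SD' SD.
have psi_le := pressure_solve_le Q1 SD' H1.
have q_le := correction_le Qq1 SD' Hq.
have yng := psd_young lP SP SD'.
have m0 := psd_ge0 massP Xu; have m0' := psd_ge0 massP Xu'.
have a0 := psd_ge0 AP Xu'.
have D0 := psd_ge0 lP SD; have D0' := psd_ge0 lP SD'.
have d0 := psd_ge0 lP Sd; have P0 := psd_ge0 lP SP.
have q0 := psd_ge0 ljP Qq1.
move: ME psi_le q_le yng m0 m0' a0 D0 D0' d0 P0 q0; rewrite /scheme_energy /=.
set m := mass u u; set m' := mass u' u'; set a := A u' u'.
set D := l (dv u) _; set D' := l (dv u') (dv u'); set d := l (dv u' - _) _.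
set p := l P P; set y := l P _; set x := e _ _; set q := l (j q1) _.
move=> ME psi_le q_le yng m0 m0' a0 D0 D0' d0 P0 q0.
set B := m + alpha * D + p.
have tau_half := tau12; have alpha_gt1 := alpha1; have rho_ge0 := rho0.
have al0 : 0 <= alpha by lra.
have ad0 : 0 <= alpha * d by rewrite mulr_ge0.
have aD0 : 0 <= alpha * D by rewrite mulr_ge0.
have ta0 : 0 <= tau * a by rewrite mulr_ge0 // ltW.
have D'le : D' <= alpha * D' by rewrite ler_peMl // ltW.
have ty : 2 * tau * y <= 1 / 2 * (p + D').
  apply: le_trans (_ : tau * (p + D') <= _).
    by rewrite mulrC mulrA mulrC ler_pM2l // mulrC.
  by rewrite ler_wpM2r ?addr_ge0 // ltW.
have DB : D' <= 2 * B by rewrite /B; lra.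
have tq : tau * rho * q <= 1 / 2 * rho * D'.
  by rewrite ler_pM ?mulr_ge0 ?ler_wpM2r // ltW.
have rD : rho * D' <= rho * (2 * B) by rewrite ler_wpM2l.
rewrite /B in DB rD *; lra.
Qed.

Context (K : nat) (u : nat -> V) (psi q p : nat -> W).
Hypotheses (u0X : X (u 0%N)) (p0Q : Q (p 0%N)).
Hypotheses (psi0 : psi 0%N = 0) (q0 : q 0%N = 0).
Hypothesis mem : forall k, (k < K)%N ->
  [/\ X (u k.+1), Q (psi k.+1) & Q (q k.+1)].
Hypothesis velocity : forall k, (k < K)%N -> forall v, X v ->
  mass (tau^-1 *: delta u k.+1) v + A (u k.+1) v
  - l (j (p k + delta psi k)) (dv v)
  + alpha * l (dv (tau^-1 *: delta u k.+1)) (dv v) = 0.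
Hypothesis projection : forall k, (k < K)%N -> forall z, Q z ->
  e (delta psi k.+1) z = - (tau^-1 * l (dv (u k.+1)) (j z)).
Hypothesis correction : forall k, (k < K)%N -> forall r, Q r ->
  l (j (delta q k.+1)) (j r) = - l (dv (u k.+1)) (j r).
Hypothesis pressure : forall k, (k < K)%N ->
  p k.+1 = psi k.+1 + rho *: q k.+1.

Definition initial_energy : R :=
  mass (u 0%N) (u 0%N) + alpha * l (dv (u 0%N)) (dv (u 0%N))
  + l (j (p 0%N)) (j (p 0%N)).

Lemma scheme_stable n : (n < K)%N ->
  mass (u n.+1) (u n.+1)
    <= expR (K%:R * tau) * ((4 + rho) * initial_energy) /\
  tau * \sum_(1 <= k < n.+2) A (u k) (u k)
    <= (4 + rho) * initial_energy * (1 + K%:R * tau * expR (K%:R * tau)).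
Proof.
move=> nK; have K0 : (0 < K)%N by case: K nK.
have Xu k : (k <= K)%N -> X (u k) by case: k => // k /mem [].
have Qpsi k : (k <= K)%N -> Q (psi k).
  by case: k => [_|k /mem [] //]; rewrite psi0; exact: psd_dom0 eP.
have Qq k : (k <= K)%N -> Q (q k).
  by case: k => [_|k /mem [] //]; rewrite q0; exact: psd_dom0 eP.
(* the scheme says nothing about the iterates beyond K, hence the cut-off *)
pose En k := if (k <= K)%N then scheme_energy (u k) (psi k) (q k) else 0.
have lqP k : (k <= K)%N -> 0 <= l (j (q k)) (j (q k)).
  by move=> kK; apply: (psd_ge0 lP); apply: jS; apply: Qq.
have lDP k : (k <= K)%N -> 0 <= l (dv (u k)) (dv (u k)).
  by move=> kK; apply: (psd_ge0 lP); apply: dvS; apply: Xu.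
have al0 : 0 <= alpha by apply: le_trans (ltW alpha1).
have mass_le k : (k <= K)%N -> mass (u k) (u k) <= En k.
  move=> kK; rewrite /En kK /scheme_energy -!addrA lerDl.
  have psi_ge0 := psd_ge0 eP (Qpsi _ kK).
  by rewrite !addr_ge0 ?mulr_ge0 ?sqr_ge0 ?lDP ?lqP // ltW.
have En0 k : 0 <= En k.
  have [kK|kK] := leqP k K; last by rewrite /En leqNgt kK.
  by apply: le_trans (mass_le _ kK); apply: (psd_ge0 massP); apply: Xu.
have a0 k : (1 <= k <= K)%N -> 0 <= A (u k) (u k).
  by move=> /andP[_ kK]; apply: (psd_ge0 AP); apply: Xu.
have I0 : 0 <= (4 + rho) * initial_energy.
  rewrite mulr_ge0 ?addr_ge0 ?mulr_ge0 ?lDP ?(psd_ge0 massP) //.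
  by apply: (psd_ge0 lP); apply: jS.
have first : En 1%N + 2 * tau * A (u 1%N) (u 1%N) <= (4 + rho) * initial_energy.
  rewrite /En K0; apply: first_energy_step => //.
  - exact: Xu.
  - exact: jS.
  - exact: Qpsi.
  - exact: Qq.
  - by have := velocity K0 (Xu _ K0); rewrite addr0.
  - by move=> z Qz; have := projection K0 Qz; rewrite /= psi0 subr0.
  - by move=> z Qz; have := correction K0 Qz; rewrite /= q0 subr0.
have step k : (1 <= k < K)%N ->
    En k.+1 - En k + 2 * tau * A (u k.+1) (u k.+1) <= tau / 2 * En k.+1.
  case: k => // k /= kK; have kK' := ltnW kK; have kK2 := ltnW kK'.
  have [X1 X2] := (Xu _ kK', Xu _ kK).
  have [Q0 Q1 Q2] := And3 (Qpsi _ kK2) (Qpsi _ kK') (Qpsi _ kK).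
  have [Qq1 Qq2] := (Qq _ kK', Qq _ kK).
  rewrite /En kK kK'; apply: (energy_step X1 X2 Q0 Q1 Q2 Qq1 Qq2).
  - by have := velocity kK (Xu _ kK); rewrite pressure.
  - by move=> z Qz; have := projection kK' Qz.
  - by move=> z Qz; have := projection kK Qz.
  - by move=> z Qz; have := correction kK Qz.
have [En_le sum_le] := discrete_gronwall tau0 tau12 I0 En0 a0 first step nK.
by split => //; apply: le_trans En_le; apply: mass_le.
Qed.

End abstract_scheme.

(** * Measurability of open sets *)

Section measurability.
Context (R : realType) (d : nat).

Lemma measurable_rV_coord i : measurable_fun setT (@rV_coord R d i).
Proof.
move=> _ A mA; rewrite setTI; apply: sub_sigma_algebra => /=.
rewrite -bigcup_seq/=; exists i => /=; first by rewrite mem_index_enum.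
by exists A => //; rewrite setTI.
Qed.

Definition rational_box (c : 'rV[rat]_d * rat) : set 'rV[R]_d :=
  [set x | forall i, `|x ord0 i - ratr (c.1 ord0 i)| < ratr c.2].

Lemma measurable_rational_box c : measurable (rational_box c).
Proof.
have -> : rational_box c = \bigcap_(i in [set: 'I_d]) (rV_coord i @^-1`
    `]ratr (c.1 ord0 i) - ratr c.2, ratr (c.1 ord0 i) + ratr c.2[%classic).
  apply/seteqP; split=> x /= Hx i.
    move=> _; have := Hx i; rewrite /= in_itv /= ltr_norml /rV_coord.
    by move=> /andP[? ?]; apply/andP; split; lra.
  have := Hx i I; rewrite /= in_itv /= ltr_norml /rV_coord.
  by move=> /andP[? ?]; apply/andP; split; lra.
apply: fin_bigcap_measurable => // i _.
rewrite -[X in measurable X]setTI; apply: measurable_rV_coord => //.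
Qed.

Lemma open_rational_box (O : set 'rV[R]_d) x : open O -> O x ->
  exists c, rational_box c x /\ rational_box c `<=` O.
Proof.
rewrite openE => /(_ x) /[apply] /nbhs_ballP [e /= e0 He].
have [r] : exists r, ratr r \in `]0%R, e / 2[ by apply: rat_in_itvoo; lra.
rewrite in_itv /= => /andP[r0 re].
have Hq i : exists q : rat, `|x ord0 i - ratr q| < ratr r.
  have : x ord0 i - ratr r < x ord0 i + ratr r by lra.
  move=> /rat_in_itvoo [q]; rewrite in_itv /= => /andP[q1 q2].
  by exists q; rewrite ltr_norml; apply/andP; split; lra.
have [q {}Hq] := choice Hq.
exists (\row_i q i, r); split; first by move=> i; rewrite mxE.
move=> y Hy; apply: He; split => // i j; rewrite (ord1 i) /ball /=.
have := Hy j; have := Hq j; rewrite /= mxE => h1 h2.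
have := ler_distD (ratr (q j)) (x ord0 j) (y ord0 j).
rewrite (distrC (ratr _)); lra.
Qed.

(** The sigma-algebra is generated by the coordinates, and an open set is a
    union of boxes with rational centre and radius, of which there are only
    countably many. *)
Lemma open_measurable_rV (O : set 'rV[R]_d) : open O -> measurable O.
Proof.
move=> oO; have -> : O = \bigcup_c
    (if `[< rational_box c `<=` O >] then rational_box c else set0).
  apply/seteqP; split=> x.
    move=> /(open_rational_box oO) [c [cx cO]]; exists c => //.
    by case: asboolP.
  by case=> c _; case: asboolP => // cO /cO.
apply: countable_bigcupT_measurable => // c; case: asboolP => _ //.
exact: measurable_rational_box.
Qed.

End measurability.

(** * The forms of the scheme *)

Section L2_theory.
Context (R : realType) (d : nat) (Omega : set 'rV[R]_d).
Hypothesis mO : measurable Omega.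
Local Notation leb := (lebesgue_rV R d).

Lemma L2_integrableM (f g : 'rV[R]_d -> R) : L2 Omega f -> L2 Omega g ->
  leb.-integrable Omega (EFin \o (fun x => f x * g x)).
Proof.
move=> [mf If] [mg Ig].
apply: (le_integrable mO _ _ (integrableD mO If Ig)).
  by apply/measurable_EFinP; exact: measurable_funM.
move=> x _ /=; rewrite lee_fin normrM.
rewrite [leRHS]ger0_norm ?addr_ge0 ?sqr_ge0 //.
(* what remains is the pointwise bound |f g| <= f ^ 2 + g ^ 2 *)
rewrite -(real_normK (num_real (f x))) -(real_normK (num_real (g x))).
have := sqr_ge0 (`|f x| - `|g x|); have := sqr_ge0 (`|f x| + `|g x|); nra.
Qed.

Lemma L2_linear a (f g : 'rV[R]_d -> R) : L2 Omega f -> L2 Omega g ->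
  L2 Omega (a *: f + g).
Proof.
move=> Lf Lg; case: (Lf) (Lg) => [mf If] [mg Ig]; split.
  apply: measurable_funD => //; apply: measurable_funM => //.
have -> : (fun x => ((a *: f + g) x ^+ 2)%:E) =
  ((fun x => ((a ^+ 2)%:E * (f x ^+ 2)%:E)%E) \+
   ((fun x => ((2 * a)%:E * (f x * g x)%:E)%E) \+ (fun x => (g x ^+ 2)%:E)))%E.
  apply/funext => x.
  have sqr_lin (y z : R) :
    (a * y + z) ^+ 2 = a ^+ 2 * y ^+ 2 + (2 * a * (y * z) + z ^+ 2) by ring.
  exact: (congr1 EFin (sqr_lin (f x) (g x))).
apply: integrableD => //; first exact: integrableZl.
apply: integrableD => //; apply: integrableZl => //.
exact: L2_integrableM.
Qed.

Lemma L2_0 : L2 Omega (0 : 'rV[R]_d -> R).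
Proof.
split; first exact: measurable_cst.
have -> : (fun x : 'rV[R]_d => ((0 : 'rV[R]_d -> R) x ^+ 2)%:E) = cst 0%E.
  by apply/funext => x; rewrite expr0n.
exact: integrable0.
Qed.

Lemma ip_psd : psd_form (L2 Omega) (ip Omega).
Proof.
split.
- exact: L2_0.
- exact: L2_linear.
- by move=> f g _ _; rewrite /ip; under eq_Rintegral do rewrite mulrC.
- move=> a f g h Lf Lg Lh; rewrite /ip.
  rewrite -RintegralZl //; last exact: L2_integrableM.
  rewrite -RintegralD //; last exact: L2_integrableM.
    apply: eq_Rintegral => x _.
    have distr (y z t : R) : (a * y + z) * t = a * (y * t) + z * t by ring.
    exact: distr.
  exact: (integrableZl mO a (L2_integrableM Lf Lh)).
- by move=> f _; apply: Rintegral_ge0 => x _; rewrite -expr2 sqr_ge0.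
Qed.

End L2_theory.

Section forms.
Context (R : realType) (d : nat) (Omega : set 'rV[R]_d).
Hypothesis mO : measurable Omega.

Lemma fin_dim_subspace0 (V : lmodType R) (X : set V) :
  fin_dim_subspace X -> X 0.
Proof.
move=> [n [b ->]]; exists (fun=> 0).
by rewrite big1 // => i _; rewrite scale0r.
Qed.

Lemma fin_dim_subspaceP (V : lmodType R) (X : set V) a u v :
  fin_dim_subspace X -> X u -> X v -> X (a *: u + v).
Proof.
move=> [n [b ->]] [c ->] [c' ->]; exists (fun i => a * c i + c' i).
rewrite scaler_sumr -big_split /=; apply: eq_bigr => i _.
by rewrite scalerDl scalerA.
Qed.

Lemma vip_psd :
  psd_form [set v : 'I_d -> 'rV[R]_d -> R | forall i, L2 Omega (v i)]
    (vip Omega).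
Proof.
have S0 : [set v : 'I_d -> 'rV[R]_d -> R | forall i, L2 Omega (v i)] 0.
  by move=> i; exact: (psd_dom0 (ip_psd mO)).
have SP a (u v : 'I_d -> 'rV[R]_d -> R) : (forall i, L2 Omega (u i)) ->
    (forall i, L2 Omega (v i)) -> forall i, L2 Omega ((a *: u + v) i).
  by move=> Lu Lv i; exact: (psd_domP (ip_psd mO) a (Lu i) (Lv i)).
apply: psd_sum => // i.
apply: (psd_pullback (ip_psd mO) (f := fun v => v i)) => //.
Qed.

Lemma tip_psd :
  psd_form
    [set v : 'I_d -> 'I_d -> 'rV[R]_d -> R | forall i j, L2 Omega (v i j)]
    (tip Omega).
Proof.
have S0 : forall i j, L2 Omega ((0 : 'I_d -> 'I_d -> 'rV[R]_d -> R) i j).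
  by move=> i j; exact: (psd_dom0 (ip_psd mO)).
have SP a (u v : 'I_d -> 'I_d -> 'rV[R]_d -> R) :
    (forall i j, L2 Omega (u i j)) ->
    (forall i j, L2 Omega (v i j)) -> forall i j, L2 Omega ((a *: u + v) i j).
  by move=> Lu Lv i j; exact: (psd_domP (ip_psd mO) a (Lu i j) (Lv i j)).
apply: psd_sum => // i.
apply: (psd_pullback vip_psd (f := fun v => v i)) => // v.
exact.
Qed.

Section velocity_forms.
Variable X : set (vector_pair R d).
Hypothesis XP : velocity_space Omega X.

Let X0 : X 0 := fin_dim_subspace0 XP.1.
Let Xlin a u v : X u -> X v -> X (a *: u + v) :=
  fin_dim_subspaceP a XP.1.
Let XL2 v : X v -> forall i j, L2 Omega (v i).1 /\ L2 Omega ((v i).2 j).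
Proof. by move=> Xv i j; have [? ? _] := XP.2 _ Xv i. Qed.

Lemma mass_psd : psd_form X (fun v w => vip Omega (fld v) (fld w)).
Proof.
by apply: (psd_pullback vip_psd) => // v Xv i; have [] := XL2 Xv i i.
Qed.

Lemma L2_strain v : X v -> forall i j, L2 Omega (strain v i j).
Proof.
move=> Xv i j; have [_ L1] := XL2 Xv i j; have [_ L2'] := XL2 Xv j i.
exact: (psd_domZ (ip_psd mO) 2^-1 (psd_domD (ip_psd mO) L1 L2')).
Qed.

Lemma partial_lin a (u v : vector_pair R d) i k x :
  ((a *: u + v) i).2 k x = a * (u i).2 k x + (v i).2 k x.
Proof. by []. Qed.

Lemma strain_lin a (u v : vector_pair R d) :
  strain (a *: u + v) = a *: strain u + strain v.
Proof.
apply/funext => i; apply/funext => k; apply/funext => x.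
transitivity (a * strain u i k x + strain v i k x); last by [].
by rewrite /strain /grad !partial_lin; ring.
Qed.

Lemma Aform_psd bc Re : 0 < Re -> psd_form X (Aform Omega bc Re).
Proof.
move=> Re0; have ReV : 0 <= Re^-1 by rewrite invr_ge0 ltW.
case: bc; apply: (psd_scale ReV); apply: (psd_pullback tip_psd) => //.
- by move=> v Xv i j; have [] := XL2 Xv i j.
- exact: L2_strain.
- exact: strain_lin.
Qed.

Lemma L2_div v : X v -> L2 Omega (div v).
Proof.
move=> Xv; have -> : div v = \sum_i (v i).2 i.
  by apply/funext => x; rewrite fct_sumE.
elim/big_ind: _ => [|f g Lf Lg|i _]; first exact: (psd_dom0 (ip_psd mO)).
  exact: (psd_domD (ip_psd mO)).
by have [] := XL2 Xv i i.
Qed.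

End velocity_forms.

Lemma div_lin a (u v : vector_pair R d) : div (a *: u + v) = a *: div u + div v.
Proof.
apply/funext => x; rewrite /div.
transitivity (\sum_i (a * (u i).2 i x + (v i).2 i x)) => //.
by rewrite big_split /= -mulr_sumr.
Qed.

Lemma H1ip_psd Q : pressure_space Omega Q -> psd_form Q (H1ip Omega).
Proof.
move=> [Qfin QH1]; have Q0 := fin_dim_subspace0 Qfin.
have Qlin a u v := fin_dim_subspaceP (u := u) (v := v) a Qfin.
apply: psd_add.
  by apply: (psd_pullback (ip_psd mO)) => // w /QH1 [].
apply: (psd_pullback vip_psd (f := snd)).
- exact: Q0.
- exact: Qlin.
- by move=> w /QH1 [_ h _].
- exact: (fun a u v => erefl).
Qed.

Lemma ip_le_H1ip w : ip Omega w.1 w.1 <= H1ip Omega w w.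
Proof.
rewrite lerDl; apply: sumr_ge0 => i _.
by apply: Rintegral_ge0 => x _; rewrite -expr2 sqr_ge0.
Qed.

End forms.

(** * Stability of the grad-div scheme *)

Theorem theorem3p1 (R : realType) (d : nat) (hd : d = 2%N \/ d = 3%N)
    (Omega : set 'rV[R]_d) (hOmega : bounded_domain Omega)
    (bc : boundary_condition)
    (T Re alpha : R) (hT : 0 < T) (hRe : 0 < Re)
    (halpha : Num.max 1 (2 / Re) < alpha)
    (u0 : 'I_d -> 'rV[R]_d -> R) (hu0 : forall i, L2 Omega (u0 i))
    (p0 : 'rV[R]_d -> R) (hp0 : L2 Omega p0)
    (* M: a bound for the divergence of the initial discrete velocity; C may
       depend on it, as part of the data used for initialization *)
    (M : R) :
  exists C : R,
  forall (X : R -> set (vector_pair R d)) (Q : R -> set (scalar_pair R d)),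
    (forall h, 0 < h -> velocity_space Omega (X h) /\ pressure_space Omega (Q h)) ->
    LBB_stable Omega X Q ->
  forall (h : R) (K : nat), 0 < h -> (0 < K)%N -> T / K%:R < 1 / 2 ->
  forall (u : nat -> vector_pair R d) (psi q p : nat -> scalar_pair R d),
    GD_scheme Omega bc Re alpha (T / K%:R) K (fun _ _ _ => 0) (fun _ _ => 0)
      (X h) (Q h) u0 p0 u psi q p ->
    L2norm Omega (div (u 0%N)) <= M ->
    \big[Num.max/0]_(0 <= k < K.+1) vL2norm Omega (u k)
    + Num.sqrt (T / K%:R * \sum_(1 <= k < K.+1) Anorm Omega bc Re (u k) ^+ 2)
    <= C.
Proof.
have mO : measurable Omega.
  by case: hOmega => _ oO _ _; exact: open_measurable_rV.
have [alpha1 alphaRe] : 1 < alpha /\ 2 * Re^-1 < alpha.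
  by move: halpha; rewrite gt_max => /andP[].
have al0 : 0 <= alpha by apply: le_trans (ltW alpha1).
have rho0 : 0 <= Re^-1 by rewrite invr_ge0 ltW.
pose G : R := (4 + Re^-1) * (vip Omega u0 u0 + alpha * M ^+ 2 + ip Omega p0 p0).
have U0 : 0 <= vip Omega u0 u0 by exact: (psd_ge0 (vip_psd mO)).
have P0 : 0 <= ip Omega p0 p0 by exact: (psd_ge0 (ip_psd mO)).
(* G bounds the energy after the first step; expR T is the growth factor *)
exists (Num.sqrt (expR T * G) + Num.sqrt (G * (1 + T * expR T))).
move=> X Q XQ _ h K h0 K0 tau12 u psi q p GD divM.
have [XP QP] := XQ h h0.
have KT : K%:R * (T / K%:R) = T by field; rewrite pnatr_eq0 -lt0n.
have tau0 : 0 < T / K%:R by rewrite divr_gt0 // ltr0n.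
have [Xu0 u0E] := GD_init_u GD; have [Qp0 p0E] := GD_init_p GD.
have QL2 w : Q h w -> L2 Omega w.1 by move=> /QP.2 [].
have massP := mass_psd mO XP.
have AP := Aform_psd mO XP bc hRe.
have XL2 v : X h v -> forall i, L2 Omega (v i).1.
  by move=> Xv i; have [] := XP.2 _ Xv i.
have m0 : vip Omega (fld (u 0%N)) (fld (u 0%N)) <= vip Omega u0 u0.
  by apply: (psd_projection_le (vip_psd mO)) => //; [exact: XL2|exact: u0E].
have p0le : ip Omega (p 0%N).1 (p 0%N).1 <= ip Omega p0 p0.
  by apply: (psd_projection_le (ip_psd mO)) => //; [exact: QL2|exact: p0E].
have D0 : ip Omega (div (u 0%N)) (div (u 0%N)) <= M ^+ 2.
  have D0 := psd_ge0 (ip_psd mO) (L2_div mO XP Xu0).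
  (* M is nonnegative because it bounds a norm *)
  rewrite -[leLHS]sqr_sqrtr // lerXn2r ?nnegrE ?sqrtr_ge0 //.
  exact: le_trans (sqrtr_ge0 _) divM.
have velocity k : (k < K)%N -> forall v, X h v ->
    vip Omega (fld ((T / K%:R)^-1 *: delta u k.+1)) (fld v)
    + Aform Omega bc Re (u k.+1) v
    - ip Omega (p k + delta psi k).1 (div v)
    + alpha * ip Omega (div ((T / K%:R)^-1 *: delta u k.+1)) (div v) = 0.
  move=> kK v Xv; rewrite (GD_velocity GD kK Xv) addr0.
  exact: (psd0l (vip_psd mO) (XL2 _ Xv)).
have stab := @scheme_stable R _ _ _ (X h) (Q h) (L2 Omega)
  (fun v w => vip Omega (fld v) (fld w)) (Aform Omega bc Re) (ip Omega)
  (H1ip Omega) (@div R d) fst massP AP (ip_psd mO) (H1ip_psd mO QP)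
  (L2_div mO XP) QL2 (@div_lin R d) (fun a u v => erefl)
  (fun w _ => ip_le_H1ip _ w)
  (T / K%:R) alpha Re^-1 tau0 tau12 alpha1 alphaRe rho0 K u psi q p Xu0 Qp0
  (GD_init_psi GD) (GD_init_q GD) (GD_mem GD) velocity (GD_projection GD)
  (GD_correction GD) (GD_pressure GD).
rewrite {}KT in stab.
set I := initial_energy _ _ _ _ _ _ _ in stab.
have IG : (4 + Re^-1) * I <= G.
  rewrite /I /G /initial_energy ler_wpM2l ?addr_ge0 // !lerD //.
  by rewrite ler_wpM2l.
have G0 : 0 <= G.
  by rewrite mulr_ge0 // !addr_ge0 // mulr_ge0 // sqr_ge0.
have eT1 : 1 <= expR T by apply: le_trans (expR_ge1Dx T); rewrite lerDl ltW.
have Xu k : (k <= K)%N -> X h (u k) by case: k => // k /(GD_mem GD) [].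
apply: lerD.
  rewrite big_nat_cond; apply: bigmax_le; first exact: sqrtr_ge0.
  move=> k; rewrite andbT /= ltnS => kK; rewrite /vL2norm ler_sqrt; last first.
    by rewrite mulr_ge0 ?expR_ge0.
  case: k kK => [_|k kK].
    apply: le_trans m0 _.
    apply: le_trans (_ : G <= _); last by rewrite ler_peMl.
    have : 0 <= alpha * M ^+ 2.
      by rewrite mulr_ge0 ?sqr_ge0.
    rewrite /G; set a := alpha * _ => a0.
    apply: le_trans (_ : 1 * (vip Omega u0 u0 + a + ip Omega p0 p0) <= _).
      by lra.
    by apply: ler_wpM2r; [rewrite !addr_ge0|lra].
  have [le_u _] := stab _ kK; apply: le_trans le_u _.
  by rewrite ler_wpM2l ?expR_ge0.
have -> : \sum_(1 <= k < K.+1) Anorm Omega bc Re (u k) ^+ 2 =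
    \sum_(1 <= k < K.+1) Aform Omega bc Re (u k) (u k).
  rewrite !big_nat; apply: eq_bigr => k /andP[_ kK].
  by rewrite sqr_sqrtr //; apply: (psd_ge0 AP); apply: Xu.
have TE : 0 <= 1 + T * expR T by rewrite addr_ge0 ?mulr_ge0 ?expR_ge0 // ltW.
rewrite ler_sqrt ?(mulr_ge0 G0 TE) //.
have := stab K.-1; rewrite prednK // leqnn => /(_ isT) [_ le_A].
by apply: le_trans le_A _; apply: ler_wpM2r.
Qed.
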